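(* Let $t,v$ be both $\lambda\mu$-terms or both $\lambda\mu$-commands. If $t\to_n v$ in one call-by-name step in the $\lambda\mu$-calculus, then there exists an expression $u$ of $\bar\lambda\mu\tilde\mu_T$ such that $t^\dag\overset{*}{\to}_n u$ and $v^\dag\overset{*}{\leadsto}_n u$.
   Context: Throughout, $x,y,\dots$ range over $\lambda$-variables and $\alpha,\beta,\delta,\dots$ over $\mu$-variables; $\lambda,\mu,\tilde\mu$ are binders, expressions are identified up to $\alpha$-equivalence and all substitutions are capture-avoiding. All one-step reductions may be applied to any subexpression (compatible closure of the displayed rules). **$\lambda\mu$-calculus.** Terms $t ::= x \mid \lambda x.t \mid (t)\,t \mid \mu\alpha.c$; commands $c ::= [\alpha]\,t$; contexts $e ::= \alpha \mid \beta(t) \mid t\cdot e$ (in $\beta(t)$, $\beta$ is any $\mu$-variable). For a context $e$ and term $t$ the command $e\{t\}$ is: $\alpha\{t\}=[\alpha]\,t$; $\beta(u)\{t\}=[\beta]\,(u)\,t$; $(u\cdot h)\{t\}=h\{(t)\,u\}$. For a $\mu$-variable $\alpha$ and context $e$, $t[\alpha\gets e]$ and $c[\alpha\gets e]$ are defined by structural recursion, commuting with all constructors except $([\alpha]\,t)[\alpha\gets e]=e\{t[\alpha\gets e]\}$ (and $([\beta]\,t)[\alpha\gets e]=[\beta]\,t[\alpha\gets e]$ for $\beta\neq\alpha$). Call-by-name one-step reduction $\to_n$ is given by the rules: - $\beta$: $(\lambda x.u)\,t\to u[x\gets t]$; - $\mu$: $(\mu\alpha.c)\,t\to\mu\alpha.\,c[\alpha\gets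 t\cdot\alpha]$ (bound $\alpha$ chosen not free in $t$); - $\rho$: $[\beta]\,\mu\alpha.c\to c[\alpha\gets\beta]$; - $\theta$: $\mu\delta.[\delta]\,t\to t$ if $\delta$ is not free in $t$. (That is, all generic rules except $\mu'$: $(t)\,\mu\alpha.c\to\mu\alpha.\,c[\alpha\gets\alpha(t)]$.) **Call-by-name calculus $\bar\lambda\mu\tilde\mu_T$.** Terms $t ::= x\mid\lambda x.t\mid\mu\alpha.c$; commands $c ::= \langle t\,|\,e\rangle$; stacks $s ::= \alpha\mid t\cdot s$; contexts $e ::= s\mid\tilde\mu x.c$. Call-by-name rules: - $\beta$: $\langle\lambda x.u\,|\,t\cdot e\rangle\to\langle t\,|\,\tilde\mu x.\langle u\,|\,e\rangle\rangle$; - $\mu_n$: $\langle\mu\alpha.c\,|\,s\rangle\to c[\alpha\gets s]$ for $s$ a stack; - $\tilde\mu$: $\langle t\,|\,\tilde\mu x.c\rangle\to c[x\gets t]$; - $\theta$: $\mu\delta.\langle t\,|\,\delta\rangle\to t$ if $\delta$ is not free in $t$. $\overset{*}{\to}_n$ is the reflexive-transitive closure of the union of these. A step is linear if it is a $\beta$-step, a $\theta$-step, a $\mu_n$-step in which $s$ is a $\mu$-variable or $\alpha$ has exactly one free occurrence in $c$, or a $\tilde\mu$-step in which $t$ is a $\lambda$-variable or $x$ has exactly one free occurrence in $c$. $\overset{*}{\leadsto}_n$ is the reflexive-transitive closure of linear call-by-name one-step reduction. **Translation $(\cdot)^\dag$.** $x^\dag=x$; $(\lambda x.u)^\dag=\lambda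 x.u^\dag$; $((u)\,v)^\dag=\mu\beta.\langle v^\dag\,|\,\tilde\mu y.\langle u^\dag\,|\,y\cdot\beta\rangle\rangle$ with $y,\beta$ not free in $u,v$; $(\mu\alpha.c)^\dag=\mu\alpha.c^\dag$; $([\alpha]\,t)^\dag=\langle t^\dag\,|\,\alpha\rangle$. *)

(* Defs.v *)
(* Both calculi are written with de Bruijn indices, so that alpha-equivalence
   is Leibniz equality.  lambda-variables and mu-variables are two separate
   index spaces: Lam and mu-tilde bind index 0 of the lambda-space, Mu binds
   index 0 of the mu-space, and dangling indices are the free variables.
   A side condition "the bound variable is not free in t" is expressed by t
   occurring, under the binder, as its renaming by the successor. *)

From Stdlib Require Import Relations.

Definition scons {A : Type} (a : A) (s : nat -> A) (n : nat) : A :=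
  match n with
  | 0 => a
  | S m => s m
  end.

Definition upr (f : nat -> nat) : nat -> nat := scons 0 (fun n => S (f n)).

Definition idr (n : nat) : nat := n.

(* LM is the lambda-mu-calculus, LMT the call-by-name calculus
   lambda-bar mu mu-tilde_T. *)
Module LM.

Inductive term : Type :=
| Var (x : nat)
| Lam (t : term)
| App (t u : term)                    (* (t) u *)
| Mu (c : command)
with command : Type :=
| Name (a : nat) (t : term).          (* [a] t *)

Inductive context : Type :=
| KVar (a : nat)
| KApp (b : nat) (t : term)           (* b(t) *)
| KPush (t : term) (e : context).     (* t . e *)

(* e{t} *)
Fixpoint fill (e : context) (t : term) : command :=
  match e with
  | KVar a => Name a t
  | KApp b u => Name b (App u t)
  | KPush u h => fill h (App t u)
  end.

(* f renames the lambda-variables, g the mu-variables. *)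
Fixpoint ren (f g : nat -> nat) (t : term) : term :=
  match t with
  | Var x => Var (f x)
  | Lam u => Lam (ren (upr f) g u)
  | App u v => App (ren f g u) (ren f g v)
  | Mu c => Mu (ren_c f (upr g) c)
  end
with ren_c (f g : nat -> nat) (c : command) : command :=
  match c with
  | Name a t => Name (g a) (ren f g t)
  end.

Fixpoint ren_k (f g : nat -> nat) (e : context) : context :=
  match e with
  | KVar a => KVar (g a)
  | KApp b t => KApp (g b) (ren f g t)
  | KPush t h => KPush (ren f g t) (ren_k f g h)
  end.

(* Parallel substitution of terms for lambda-variables and of contexts for
   mu-variables; a mu-variable a left alone is mapped to the context [KVar a],
   for which [fill (KVar a) t] is [Name a t]. *)
Fixpoint subst (s : nat -> term) (k : nat -> context) (t : term) : term :=
  match t with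
  | Var x => s x
  | Lam u =>
      Lam (subst (scons (Var 0) (fun n => ren S idr (s n)))
                 (fun n => ren_k S idr (k n)) u)
  | App u v => App (subst s k u) (subst s k v)
  | Mu c =>
      Mu (subst_c (fun n => ren idr S (s n))
                  (scons (KVar 0) (fun n => ren_k idr S (k n))) c)
  end
with subst_c (s : nat -> term) (k : nat -> context) (c : command) : command :=
  match c with
  | Name a t => fill (k a) (subst s k t)
  end.

(* Call-by-name rules, at the root of a term and of a command.  In [red_mu]
   the mu-variable 0 is not eliminated: it is bound again by the outer [Mu]. *)
Inductive root_term : term -> term -> Prop :=
| red_beta u t :
    root_term (App (Lam u) t) (subst (scons t Var) KVar u)
| red_mu c t :
    root_term
      (App (Mu c) t)
      (Mu (subst_c Var
             (scons (KPush (ren idr S t) (KVar 0)) (fun n => KVar (S n))) c))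
| red_theta t :
    root_term (Mu (Name 0 (ren idr S t))) t.

Inductive root_command : command -> command -> Prop :=
| red_rho b c :
    root_command (Name b (Mu c)) (subst_c Var (scons (KVar b) KVar) c).

Inductive step : term -> term -> Prop :=
| step_root t t' : root_term t t' -> step t t'
| step_lam t t' : step t t' -> step (Lam t) (Lam t')
| step_app_l t t' u : step t t' -> step (App t u) (App t' u)
| step_app_r t u u' : step u u' -> step (App t u) (App t u')
| step_mu c c' : step_c c c' -> step (Mu c) (Mu c')
with step_c : command -> command -> Prop :=
| step_c_root c c' : root_command c c' -> step_c c c'
| step_c_name a t t' : step t t' -> step_c (Name a t) (Name a t').

End LM.

Module LMT.

Inductive term : Type :=
| Var (x : nat)
| Lam (t : term)
| Mu (c : command)
with command : Type :=
| Cut (t : term) (e : context)        (* < t | e > *)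
with stack : Type :=
| SVar (a : nat)
| SPush (t : term) (s : stack)        (* t . s *)
with context : Type :=
| Stk (s : stack)
| MuT (c : command).                  (* mu-tilde x . c *)

Fixpoint ren (f g : nat -> nat) (t : term) : term :=
  match t with
  | Var x => Var (f x)
  | Lam u => Lam (ren (upr f) g u)
  | Mu c => Mu (ren_c f (upr g) c)
  end
with ren_c (f g : nat -> nat) (c : command) : command :=
  match c with
  | Cut t e => Cut (ren f g t) (ren_e f g e)
  end
with ren_s (f g : nat -> nat) (s : stack) : stack :=
  match s with
  | SVar a => SVar (g a)
  | SPush t s' => SPush (ren f g t) (ren_s f g s')
  end
with ren_e (f g : nat -> nat) (e : context) : context :=
  match e with
  | Stk s => Stk (ren_s f g s)
  | MuT c => MuT (ren_c (upr f) g c)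
  end.

Definition up_lam_t (r : nat -> term) : nat -> term :=
  scons (Var 0) (fun n => ren S idr (r n)).
Definition up_lam_s (k : nat -> stack) : nat -> stack :=
  fun n => ren_s S idr (k n).
Definition up_mu_t (r : nat -> term) : nat -> term :=
  fun n => ren idr S (r n).
Definition up_mu_s (k : nat -> stack) : nat -> stack :=
  scons (SVar 0) (fun n => ren_s idr S (k n)).

(* Parallel substitution of terms for lambda-variables and of stacks for
   mu-variables. *)
Fixpoint subst (r : nat -> term) (k : nat -> stack) (t : term) : term :=
  match t with
  | Var x => r x
  | Lam u => Lam (subst (up_lam_t r) (up_lam_s k) u)
  | Mu c => Mu (subst_c (up_mu_t r) (up_mu_s k) c)
  end
with subst_c (r : nat -> term) (k : nat -> stack) (c : command) : command :=
  match c with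
  | Cut t e => Cut (subst r k t) (subst_e r k e)
  end
with subst_s (r : nat -> term) (k : nat -> stack) (s : stack) : stack :=
  match s with
  | SVar a => k a
  | SPush t s' => SPush (subst r k t) (subst_s r k s')
  end
with subst_e (r : nat -> term) (k : nat -> stack) (e : context) : context :=
  match e with
  | Stk s => Stk (subst_s r k s)
  | MuT c => MuT (subst_c (up_lam_t r) (up_lam_s k) c)
  end.

(* Number of free occurrences of the lambda-variable x. *)
Fixpoint occ_lam (x : nat) (t : term) : nat :=
  match t with
  | Var y => if Nat.eqb x y then 1 else 0
  | Lam u => occ_lam (S x) u
  | Mu c => occ_lam_c x c
  end
with occ_lam_c (x : nat) (c : command) : nat :=
  match c with
  | Cut t e => occ_lam x t + occ_lam_e x e
  end
with occ_lam_s (x : nat) (s : stack) : nat :=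
  match s with
  | SVar _ => 0
  | SPush t s' => occ_lam x t + occ_lam_s x s'
  end
with occ_lam_e (x : nat) (e : context) : nat :=
  match e with
  | Stk s => occ_lam_s x s
  | MuT c => occ_lam_c (S x) c
  end.

(* Number of free occurrences of the mu-variable a. *)
Fixpoint occ_mu (a : nat) (t : term) : nat :=
  match t with
  | Var _ => 0
  | Lam u => occ_mu a u
  | Mu c => occ_mu_c (S a) c
  end
with occ_mu_c (a : nat) (c : command) : nat :=
  match c with
  | Cut t e => occ_mu a t + occ_mu_e a e
  end
with occ_mu_s (a : nat) (s : stack) : nat :=
  match s with
  | SVar b => if Nat.eqb a b then 1 else 0
  | SPush t s' => occ_mu a t + occ_mu_s a s'
  end
with occ_mu_e (a : nat) (e : context) : nat :=
  match e with
  | Stk s => occ_mu_s a s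
  | MuT c => occ_mu_c a c
  end.

(* Call-by-name rules, at the root.  In [red_beta] the context e of t . e is
   necessarily a stack. *)
Inductive root_term : term -> term -> Prop :=
| red_theta t :
    root_term (Mu (Cut (ren idr S t) (Stk (SVar 0)))) t.

Inductive root_command : command -> command -> Prop :=
| red_beta u t s :
    root_command
      (Cut (Lam u) (Stk (SPush t s)))
      (Cut t (MuT (Cut u (Stk (ren_s S idr s)))))
| red_mu c s :
    root_command (Cut (Mu c) (Stk s)) (subst_c Var (scons s SVar) c)
| red_mut t c :
    root_command (Cut t (MuT c)) (subst_c (scons t Var) SVar c).

(* The linear instances of the command rules; theta-steps are all linear. *)
Inductive linear_root_command : command -> command -> Prop :=
| lin_beta u t s :
    linear_root_command
      (Cut (Lam u) (Stk (SPush t s)))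
      (Cut t (MuT (Cut u (Stk (ren_s S idr s)))))
| lin_mu c s :
    (exists a, s = SVar a) \/ occ_mu_c 0 c = 1 ->
    linear_root_command (Cut (Mu c) (Stk s)) (subst_c Var (scons s SVar) c)
| lin_mut t c :
    (exists x, t = Var x) \/ occ_lam_c 0 c = 1 ->
    linear_root_command (Cut t (MuT c)) (subst_c (scons t Var) SVar c).

Inductive compat (RT : term -> term -> Prop) (RC : command -> command -> Prop)
  : term -> term -> Prop :=
| compat_root t t' : RT t t' -> compat RT RC t t'
| compat_lam t t' : compat RT RC t t' -> compat RT RC (Lam t) (Lam t')
| compat_mu c c' : compat_c RT RC c c' -> compat RT RC (Mu c) (Mu c')
with compat_c (RT : term -> term -> Prop) (RC : command -> command -> Prop)
  : command -> command -> Prop :=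
| compat_c_root c c' : RC c c' -> compat_c RT RC c c'
| compat_c_l t t' e : compat RT RC t t' -> compat_c RT RC (Cut t e) (Cut t' e)
| compat_c_r t e e' : compat_e RT RC e e' -> compat_c RT RC (Cut t e) (Cut t e')
with compat_s (RT : term -> term -> Prop) (RC : command -> command -> Prop)
  : stack -> stack -> Prop :=
| compat_s_l t t' s :
    compat RT RC t t' -> compat_s RT RC (SPush t s) (SPush t' s)
| compat_s_r t s s' :
    compat_s RT RC s s' -> compat_s RT RC (SPush t s) (SPush t s')
with compat_e (RT : term -> term -> Prop) (RC : command -> command -> Prop)
  : context -> context -> Prop :=
| compat_e_stk s s' : compat_s RT RC s s' -> compat_e RT RC (Stk s) (Stk s')
| compat_e_mut c c' : compat_c RT RC c c' -> compat_e RT RC (MuT c) (MuT c').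

Definition step : term -> term -> Prop := compat root_term root_command.
Definition step_c : command -> command -> Prop :=
  compat_c root_term root_command.

Definition linear_step : term -> term -> Prop :=
  compat root_term linear_root_command.
Definition linear_step_c : command -> command -> Prop :=
  compat_c root_term linear_root_command.

Definition reduces : term -> term -> Prop := clos_refl_trans term step.
Definition reduces_c : command -> command -> Prop :=
  clos_refl_trans command step_c.

Definition linear_reduces : term -> term -> Prop :=
  clos_refl_trans term linear_step.
Definition linear_reduces_c : command -> command -> Prop :=
  clos_refl_trans command linear_step_c.

End LMT.

(* In the application case, v is placed under the new mu-binder only, u under
   both new binders. *)
Fixpoint dag (t : LM.term) : LMT.term :=
  match t with
  | LM.Var x => LMT.Var x
  | LM.Lam u => LMT.Lam (dag u)
  | LM.App u v =>
      LMT.Mu (LMT.Cut (LMT.ren idr S (dag v))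
        (LMT.MuT (LMT.Cut (LMT.ren S S (dag u))
          (LMT.Stk (LMT.SPush (LMT.Var 0) (LMT.SVar 0))))))
  | LM.Mu c => LMT.Mu (dag_c c)
  end
with dag_c (c : LM.command) : LMT.command :=
  match c with
  | LM.Name a t => LMT.Cut (dag t) (LMT.Stk (LMT.SVar a))
  end.

(* Main.v *)
From Stdlib Require Import Relations.
Require Import Defs.

(** The translation sends an application to a command in which the argument is
    first named by a mu-tilde and then pushed on the stack.  One linear
    mu-tilde-step undoes the naming ([app_push]):
      [((u)v)† ⤳ μβ.⟨u† | v†·β⟩],
    and, since [β] occurs once there, one more linear step against a stack [s]
    gives [⟨((u)v)† | s⟩ ⤳* ⟨u† | v†·s⟩].  Iterating, for a context [e] built
    from a mu-variable by pushes, with image [s], one gets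
    [(e{t})† ⤳* ⟨t† | s⟩] ([dag_fill]).

    Hence substitution and translation commute up to linear reduction:
      [(t[x ← u, α ← e])† ⤳* t†[x ← u†, α ← s]]        ([dag_subst]).
    The two sides are not equal, because structural substitution creates
    applications, translated with cuts that are absent from the
    right-hand side.  This lemma is what produces the common reduct: for each of
    the rules beta, mu and rho, the translated redex reduces to the
    translated body under the translated substitution, which is the right-hand
    side above, while the translated contractum is the left-hand side.  A
    theta-redex is translated to a theta-redex, contracted to the translated
    contractum.

    Closure under subexpressions is immediate except below an application,
    whose translation renames the translated subterms apart from the two new
    binders; there one uses that both reductions are stable under renaming
    ([step_ren], [linear_step_ren]).  Arbitrary renamings preserve linearity,
    even those that identify variables: it is a condition on one bound
    variable, which a renaming lifted under its binder fixes and keeps apart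
    from all the others. *)

Import LMT.

Scheme lmt_term_mut := Induction for LMT.term Sort Prop
with lmt_command_mut := Induction for LMT.command Sort Prop
with lmt_stack_mut := Induction for LMT.stack Sort Prop
with lmt_context_mut := Induction for LMT.context Sort Prop.
Combined Scheme lmt_ind from
  lmt_term_mut, lmt_command_mut, lmt_stack_mut, lmt_context_mut.

Scheme lm_term_mut := Induction for LM.term Sort Prop
with lm_command_mut := Induction for LM.command Sort Prop.
Combined Scheme lm_ind from lm_term_mut, lm_command_mut.

Scheme compat_elim := Minimality for compat Sort Prop
with compat_c_elim := Minimality for compat_c Sort Prop
with compat_s_elim := Minimality for compat_s Sort Prop
with compat_e_elim := Minimality for compat_e Sort Prop.
Combined Scheme compat_ind_all from
  compat_elim, compat_c_elim, compat_s_elim, compat_e_elim.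

Scheme lm_step_mut := Minimality for LM.step Sort Prop
with lm_step_c_mut := Minimality for LM.step_c Sort Prop.
Combined Scheme lm_step_ind from lm_step_mut, lm_step_c_mut.

(** * Renaming and substitution *)

(** In the composition laws below the composite substitution is any one that
    agrees pointwise with the composition.  Each law thus contains its own
    extensionality, and no equality between functions is ever needed. *)
Lemma ren_ren_all :
  (forall t f g f' g' f'' g'',
     (forall n, f' (f n) = f'' n) -> (forall n, g' (g n) = g'' n) ->
     ren f' g' (ren f g t) = ren f'' g'' t) /\
  (forall c f g f' g' f'' g'',
     (forall n, f' (f n) = f'' n) -> (forall n, g' (g n) = g'' n) ->
     ren_c f' g' (ren_c f g c) = ren_c f'' g'' c) /\
  (forall s f g f' g' f'' g'',
     (forall n, f' (f n) = f'' n) -> (forall n, g' (g n) = g'' n) ->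
     ren_s f' g' (ren_s f g s) = ren_s f'' g'' s) /\
  (forall e f g f' g' f'' g'',
     (forall n, f' (f n) = f'' n) -> (forall n, g' (g n) = g'' n) ->
     ren_e f' g' (ren_e f g e) = ren_e f'' g'' e).
Proof.
  apply lmt_ind; simpl; intros; auto; f_equal; eauto;
    match goal with H : _ |- _ => apply H end; auto;
    intros [|n]; simpl; auto.
Qed.

Definition ren_ren := proj1 ren_ren_all.
Definition ren_ren_s := proj1 (proj2 (proj2 ren_ren_all)).

Lemma ren_comm t f1 g1 f2 g2 f3 g3 f4 g4 :
  (forall n, f1 (f2 n) = f3 (f4 n)) -> (forall n, g1 (g2 n) = g3 (g4 n)) ->
  ren f1 g1 (ren f2 g2 t) = ren f3 g3 (ren f4 g4 t).
Proof.
  intros Hf Hg.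
  rewrite (ren_ren t f2 g2 f1 g1 _ _ Hf Hg).
  symmetry; apply ren_ren; reflexivity.
Qed.

Lemma ren_comm_s s f1 g1 f2 g2 f3 g3 f4 g4 :
  (forall n, f1 (f2 n) = f3 (f4 n)) -> (forall n, g1 (g2 n) = g3 (g4 n)) ->
  ren_s f1 g1 (ren_s f2 g2 s) = ren_s f3 g3 (ren_s f4 g4 s).
Proof.
  intros Hf Hg.
  rewrite (ren_ren_s s f2 g2 f1 g1 _ _ Hf Hg).
  symmetry; apply ren_ren_s; reflexivity.
Qed.

Lemma subst_ren_all :
  (forall t f g r k r' k',
     (forall n, r (f n) = r' n) -> (forall n, k (g n) = k' n) ->
     subst r k (ren f g t) = subst r' k' t) /\
  (forall c f g r k r' k',
     (forall n, r (f n) = r' n) -> (forall n, k (g n) = k' n) ->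
     subst_c r k (ren_c f g c) = subst_c r' k' c) /\
  (forall s f g r k r' k',
     (forall n, r (f n) = r' n) -> (forall n, k (g n) = k' n) ->
     subst_s r k (ren_s f g s) = subst_s r' k' s) /\
  (forall e f g r k r' k',
     (forall n, r (f n) = r' n) -> (forall n, k (g n) = k' n) ->
     subst_e r k (ren_e f g e) = subst_e r' k' e).
Proof.
  apply lmt_ind; simpl; intros; auto; f_equal; eauto;
    match goal with H : _ |- _ => apply H end;
    unfold up_lam_t, up_lam_s, up_mu_t, up_mu_s;
    try (intros [|n]); simpl; intros; f_equal; auto.
Qed.

Definition subst_ren := proj1 subst_ren_all.
Definition subst_ren_c := proj1 (proj2 subst_ren_all).

Lemma subst_as_ren_all :
  (forall t f g r k,
     (forall n, r n = Var (f n)) -> (forall n, k n = SVar (g n)) ->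
     subst r k t = ren f g t) /\
  (forall c f g r k,
     (forall n, r n = Var (f n)) -> (forall n, k n = SVar (g n)) ->
     subst_c r k c = ren_c f g c) /\
  (forall s f g r k,
     (forall n, r n = Var (f n)) -> (forall n, k n = SVar (g n)) ->
     subst_s r k s = ren_s f g s) /\
  (forall e f g r k,
     (forall n, r n = Var (f n)) -> (forall n, k n = SVar (g n)) ->
     subst_e r k e = ren_e f g e).
Proof.
  apply lmt_ind; simpl; intros; auto; f_equal; eauto;
    match goal with H : _ |- _ => apply H end;
    unfold up_lam_t, up_lam_s, up_mu_t, up_mu_s;
    try (intros [|n]); simpl; intros; auto;
    match goal with H : forall n, _ n = _ |- _ => rewrite H; auto end.
Qed.

Definition subst_as_ren := proj1 subst_as_ren_all.

Lemma subst_id_all :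
  (forall t r k,
     (forall n, r n = Var n) -> (forall n, k n = SVar n) ->
     subst r k t = t) /\
  (forall c r k,
     (forall n, r n = Var n) -> (forall n, k n = SVar n) ->
     subst_c r k c = c) /\
  (forall s r k,
     (forall n, r n = Var n) -> (forall n, k n = SVar n) ->
     subst_s r k s = s) /\
  (forall e r k,
     (forall n, r n = Var n) -> (forall n, k n = SVar n) ->
     subst_e r k e = e).
Proof.
  apply lmt_ind; simpl; intros; auto; f_equal; eauto;
    match goal with H : _ |- _ => apply H end;
    unfold up_lam_t, up_lam_s, up_mu_t, up_mu_s;
    try (intros [|n]); simpl; intros; auto;
    match goal with H : forall n, _ n = _ |- _ => rewrite H; auto end.
Qed.

Definition subst_id := proj1 subst_id_all.

Lemma ren_subst_all :
  (forall t f g r k r' k',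
     (forall n, ren f g (r n) = r' n) -> (forall n, ren_s f g (k n) = k' n) ->
     ren f g (subst r k t) = subst r' k' t) /\
  (forall c f g r k r' k',
     (forall n, ren f g (r n) = r' n) -> (forall n, ren_s f g (k n) = k' n) ->
     ren_c f g (subst_c r k c) = subst_c r' k' c) /\
  (forall s f g r k r' k',
     (forall n, ren f g (r n) = r' n) -> (forall n, ren_s f g (k n) = k' n) ->
     ren_s f g (subst_s r k s) = subst_s r' k' s) /\
  (forall e f g r k r' k',
     (forall n, ren f g (r n) = r' n) -> (forall n, ren_s f g (k n) = k' n) ->
     ren_e f g (subst_e r k e) = subst_e r' k' e).
Proof.
  apply lmt_ind; simpl; intros; auto; f_equal; eauto;
    match goal with H : _ |- _ => apply H end;
    unfold up_lam_t, up_lam_s, up_mu_t, up_mu_s;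
    try (intros [|n]); simpl; intros; auto;
    match goal with H : forall n, _ = ?h n |- _ = _ (?h _) => rewrite <- H end;
    (apply ren_comm || apply ren_comm_s); reflexivity.
Qed.

Definition ren_subst := proj1 ren_subst_all.
Definition ren_subst_c := proj1 (proj2 ren_subst_all).

Lemma subst_shift_mu t s : subst Var (scons s SVar) (ren idr S t) = t.
Proof.
  rewrite (subst_ren t idr S _ _ Var SVar); try reflexivity.
  apply subst_id; reflexivity.
Qed.

Lemma subst_shift_lam_mu t u :
  subst (scons u Var) SVar (ren S S t) = ren idr S t.
Proof.
  rewrite (subst_ren t S S _ _ Var (fun n => SVar (S n))); try reflexivity.
  apply subst_as_ren; reflexivity.
Qed.

Lemma ren_shift_lam_mu f g t :
  ren (upr f) (upr g) (ren S S t) = ren S S (ren f g t).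
Proof. apply ren_comm; reflexivity. Qed.

Lemma ren_shift_mu f g t :
  ren f (upr g) (ren idr S t) = ren idr S (ren f g t).
Proof. apply ren_comm; reflexivity. Qed.

(** * Occurrence counts under renaming *)

Lemma occ_lam_ren_all :
  (forall t x x' f g, (forall n, Nat.eqb x' (f n) = Nat.eqb x n) ->
     occ_lam x' (ren f g t) = occ_lam x t) /\
  (forall c x x' f g, (forall n, Nat.eqb x' (f n) = Nat.eqb x n) ->
     occ_lam_c x' (ren_c f g c) = occ_lam_c x c) /\
  (forall s x x' f g, (forall n, Nat.eqb x' (f n) = Nat.eqb x n) ->
     occ_lam_s x' (ren_s f g s) = occ_lam_s x s) /\
  (forall e x x' f g, (forall n, Nat.eqb x' (f n) = Nat.eqb x n) ->
     occ_lam_e x' (ren_e f g e) = occ_lam_e x e).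
Proof.
  apply lmt_ind; simpl; intros; auto;
    try (match goal with H : _ |- _ => rewrite H; reflexivity end);
    match goal with H : _ |- _ => apply H end; intros [|n]; simpl; auto.
Qed.

Definition occ_lam_ren_c := proj1 (proj2 occ_lam_ren_all).

Lemma occ_mu_ren_all :
  (forall t a a' f g, (forall n, Nat.eqb a' (g n) = Nat.eqb a n) ->
     occ_mu a' (ren f g t) = occ_mu a t) /\
  (forall c a a' f g, (forall n, Nat.eqb a' (g n) = Nat.eqb a n) ->
     occ_mu_c a' (ren_c f g c) = occ_mu_c a c) /\
  (forall s a a' f g, (forall n, Nat.eqb a' (g n) = Nat.eqb a n) ->
     occ_mu_s a' (ren_s f g s) = occ_mu_s a s) /\
  (forall e a a' f g, (forall n, Nat.eqb a' (g n) = Nat.eqb a n) ->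
     occ_mu_e a' (ren_e f g e) = occ_mu_e a e).
Proof.
  apply lmt_ind; simpl; intros; auto;
    try (match goal with H : _ |- _ => rewrite H; reflexivity end);
    match goal with H : _ |- _ => apply H end; intros [|n]; simpl; auto.
Qed.

Definition occ_mu_ren_c := proj1 (proj2 occ_mu_ren_all).

Lemma occ_lam_fresh_all :
  (forall t x f g, (forall n, Nat.eqb x (f n) = false) ->
     occ_lam x (ren f g t) = 0) /\
  (forall c x f g, (forall n, Nat.eqb x (f n) = false) ->
     occ_lam_c x (ren_c f g c) = 0) /\
  (forall s x f g, (forall n, Nat.eqb x (f n) = false) ->
     occ_lam_s x (ren_s f g s) = 0) /\
  (forall e x f g, (forall n, Nat.eqb x (f n) = false) ->
     occ_lam_e x (ren_e f g e) = 0).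
Proof.
  apply lmt_ind; simpl; intros;
    repeat match goal with
      IH : forall _ _ _, _ -> _ = 0 |- _ =>
        rewrite IH by (try (intros [|n]; simpl); auto); clear IH
    end; auto.
  all: match goal with H : forall n, _ = false |- _ => rewrite H; auto end.
Qed.

Definition occ_lam_fresh := proj1 occ_lam_fresh_all.

Lemma occ_mu_fresh_all :
  (forall t a f g, (forall n, Nat.eqb a (g n) = false) ->
     occ_mu a (ren f g t) = 0) /\
  (forall c a f g, (forall n, Nat.eqb a (g n) = false) ->
     occ_mu_c a (ren_c f g c) = 0) /\
  (forall s a f g, (forall n, Nat.eqb a (g n) = false) ->
     occ_mu_s a (ren_s f g s) = 0) /\
  (forall e a f g, (forall n, Nat.eqb a (g n) = false) ->
     occ_mu_e a (ren_e f g e) = 0).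
Proof.
  apply lmt_ind; simpl; intros;
    repeat match goal with
      IH : forall _ _ _, _ -> _ = 0 |- _ =>
        rewrite IH by (try (intros [|n]; simpl); auto); clear IH
    end; auto.
  all: match goal with H : forall n, _ = false |- _ => rewrite H; auto end.
Qed.

Definition occ_mu_fresh := proj1 occ_mu_fresh_all.

(** * Reduction: renaming and congruence *)

(** A bound variable is neither moved by a lifted renaming nor confused with
    another one; this is all that the stability of linearity under renaming
    rests on. *)
Lemma upr_eqb_0 f n : Nat.eqb 0 (upr f n) = Nat.eqb 0 n.
Proof. destruct n; reflexivity. Qed.

Lemma compat_ren (RT : term -> term -> Prop) (RC : command -> command -> Prop) :
  (forall f g t t', RT t t' -> RT (ren f g t) (ren f g t')) ->
  (forall f g c c', RC c c' -> RC (ren_c f g c) (ren_c f g c')) ->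
  forall f g t t', compat RT RC t t' -> compat RT RC (ren f g t) (ren f g t').
Proof.
  intros HT HC.
  cut (forall t t', compat RT RC t t' ->
         forall f g, compat RT RC (ren f g t) (ren f g t')); [auto|].
  apply (compat_elim RT RC
    (fun t t' => forall f g, compat RT RC (ren f g t) (ren f g t'))
    (fun c c' => forall f g, compat_c RT RC (ren_c f g c) (ren_c f g c'))
    (fun s s' => forall f g, compat_s RT RC (ren_s f g s) (ren_s f g s'))
    (fun e e' => forall f g, compat_e RT RC (ren_e f g e) (ren_e f g e')));
    simpl; intros; constructor; solve [auto].
Qed.

Lemma root_term_ren f g t t' :
  root_term t t' -> root_term (ren f g t) (ren f g t').
Proof.
  intros []; simpl. rewrite ren_shift_mu. constructor.
Qed.

Lemma ren_subst_c_mu f g s c :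
  ren_c f g (subst_c Var (scons s SVar) c) =
  subst_c Var (scons (ren_s f g s) SVar) (ren_c f (upr g) c).
Proof.
  rewrite (ren_subst_c c f g _ _ (fun n => Var (f n))
             (scons (ren_s f g s) (fun n => SVar (g n)))).
  - symmetry; apply subst_ren_c; intros [|n]; reflexivity.
  - reflexivity.
  - intros [|n]; reflexivity.
Qed.

Lemma ren_subst_lam f g t u :
  ren f g (subst (scons t Var) SVar u) =
  subst (scons (ren f g t) Var) SVar (ren (upr f) g u).
Proof.
  rewrite (ren_subst u f g _ _ (scons (ren f g t) (fun n => Var (f n)))
             (fun n => SVar (g n))).
  - symmetry; apply subst_ren; intros [|n]; reflexivity.
  - intros [|n]; reflexivity.
  - reflexivity.
Qed.

Lemma ren_subst_c_lam f g t c :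
  ren_c f g (subst_c (scons t Var) SVar c) =
  subst_c (scons (ren f g t) Var) SVar (ren_c (upr f) g c).
Proof.
  rewrite (ren_subst_c c f g _ _ (scons (ren f g t) (fun n => Var (f n)))
             (fun n => SVar (g n))).
  - symmetry; apply subst_ren_c; intros [|n]; reflexivity.
  - intros [|n]; reflexivity.
  - reflexivity.
Qed.

Lemma ren_shift_lam_s f g s :
  ren_s (upr f) g (ren_s S idr s) = ren_s S idr (ren_s f g s).
Proof. apply ren_comm_s; reflexivity. Qed.

Lemma root_command_ren f g c c' :
  root_command c c' -> root_command (ren_c f g c) (ren_c f g c').
Proof.
  intros []; simpl.
  - rewrite ren_shift_lam_s; constructor.
  - rewrite ren_subst_c_mu; constructor.
  - rewrite ren_subst_c_lam; constructor.
Qed.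

Lemma linear_root_command_ren f g c c' :
  linear_root_command c c' ->
  linear_root_command (ren_c f g c) (ren_c f g c').
Proof.
  intros [u t s|c0 s H|t c0 H]; simpl.
  - rewrite ren_shift_lam_s; constructor.
  - rewrite ren_subst_c_mu; constructor.
    destruct H as [[a ->]|H]; simpl; eauto.
    right; rewrite <- H; apply occ_mu_ren_c, upr_eqb_0.
  - rewrite ren_subst_c_lam; constructor.
    destruct H as [[x ->]|H]; simpl; eauto.
    right; rewrite <- H; apply occ_lam_ren_c, upr_eqb_0.
Qed.

Lemma linear_step_ren f g t t' :
  linear_step t t' -> linear_step (ren f g t) (ren f g t').
Proof. apply compat_ren; auto using root_term_ren, linear_root_command_ren. Qed.

Lemma step_ren f g t t' : step t t' -> step (ren f g t) (ren f g t').
Proof. apply compat_ren; auto using root_term_ren, root_command_ren. Qed.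

Lemma linear_root_command_root c c' :
  linear_root_command c c' -> root_command c c'.
Proof. intros []; constructor. Qed.

Lemma linear_step_step t t' : linear_step t t' -> step t t'.
Proof.
  revert t t'.
  apply (compat_elim root_term linear_root_command step step_c
    (compat_s root_term root_command) (compat_e root_term root_command));
    intros; constructor; solve [auto using linear_root_command_root].
Qed.

Lemma clos_rt_map {A B : Type} (R : relation A) (R' : relation B) (F : A -> B) :
  (forall x y, R x y -> R' (F x) (F y)) ->
  forall x y, clos_refl_trans A R x y -> clos_refl_trans B R' (F x) (F y).
Proof.
  intros HF x y H; induction H; [apply rt_step | apply rt_refl | eapply rt_trans];
    eauto.
Qed.

Section Congruence.

Variables (RT : term -> term -> Prop) (RC : command -> command -> Prop).

Let red := clos_refl_trans term (compat RT RC).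
Let red_c := clos_refl_trans command (compat_c RT RC).

Lemma red_lam t t' : red t t' -> red (Lam t) (Lam t').
Proof. apply clos_rt_map; constructor; assumption. Qed.

Lemma red_mu_cong c c' : red_c c c' -> red (Mu c) (Mu c').
Proof. apply clos_rt_map; constructor; assumption. Qed.

Lemma red_cut_l e t t' : red t t' -> red_c (Cut t e) (Cut t' e).
Proof. apply (clos_rt_map _ _ (fun t => Cut t e)); constructor; assumption. Qed.

Lemma red_cut_mut t c c' : red_c c c' -> red_c (Cut t (MuT c)) (Cut t (MuT c')).
Proof.
  apply (clos_rt_map _ _ (fun c => Cut t (MuT c))); intros.
  apply compat_c_r, compat_e_mut; assumption.
Qed.

End Congruence.

(** * Translated applications *)

(** Defined on all terms, not only on translations, since substitution and
    reduction lead out of the image of [dag]. *)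
Definition app (t v : term) : term :=
  Mu (Cut (ren idr S v)
        (MuT (Cut (ren S S t) (Stk (SPush (Var 0) (SVar 0)))))).

Lemma subst_app r k t v : subst r k (app t v) = app (subst r k t) (subst r k v).
Proof.
  unfold app; simpl; repeat f_equal.
  - rewrite (ren_subst v idr S r k _ _ (fun n => eq_refl) (fun n => eq_refl)).
    apply subst_ren; reflexivity.
  - rewrite (ren_subst t S S r k _ _ (fun n => eq_refl) (fun n => eq_refl)).
    apply subst_ren; intros n; [apply ren_ren | apply ren_ren_s]; reflexivity.
Qed.

Lemma red_app (RT : term -> term -> Prop) (RC : command -> command -> Prop) :
  (forall f g t t', compat RT RC t t' -> compat RT RC (ren f g t) (ren f g t')) ->
  forall t t' v v',
    clos_refl_trans term (compat RT RC) t t' ->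
    clos_refl_trans term (compat RT RC) v v' ->
    clos_refl_trans term (compat RT RC) (app t v) (app t' v').
Proof.
  intros Hren t t' v v' Ht Hv; apply red_mu_cong; eapply rt_trans.
  - apply red_cut_l, (clos_rt_map (compat RT RC) _ _ (Hren idr S)), Hv.
  - apply red_cut_mut, red_cut_l, (clos_rt_map (compat RT RC) _ _ (Hren S S)), Ht.
Qed.

(** The step is linear because [t] is renamed apart from the name given to the
    argument, which thus occurs only at the top of the stack.  Contracting this
    redex before any redex of [t] also makes the simulation of beta and mu a
    direct computation on [t]. *)
Lemma app_push t v :
  linear_step (app t v)
    (Mu (Cut (ren idr S t) (Stk (SPush (ren idr S v) (SVar 0))))).
Proof.
  apply compat_mu, compat_c_root.
  rewrite <- (subst_shift_lam_mu t (ren idr S v)).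
  apply (lin_mut (ren idr S v)
           (Cut (ren S S t) (Stk (SPush (Var 0) (SVar 0))))).
  right; simpl; rewrite occ_lam_fresh; reflexivity.
Qed.

(** The mu-variable bound by the translated application occurs once, so that
    passing it the stack [s] is linear although [s] is arbitrary. *)
Lemma cut_app t v s :
  linear_reduces_c (Cut (app t v) (Stk s)) (Cut t (Stk (SPush v s))).
Proof.
  eapply rt_trans.
  - apply rt_step, compat_c_l, app_push.
  - apply rt_step, compat_c_root.
    replace (Cut t (Stk (SPush v s))) with
      (subst_c Var (scons s SVar)
         (Cut (ren idr S t) (Stk (SPush (ren idr S v) (SVar 0))))).
    + apply lin_mu; right; simpl.
      rewrite !occ_mu_fresh; reflexivity.
    + simpl; rewrite !subst_shift_mu; reflexivity.
Qed.

(** * Translation and substitution *)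

Lemma dag_ren_all :
  (forall t f g, dag (LM.ren f g t) = ren f g (dag t)) /\
  (forall c f g, dag_c (LM.ren_c f g c) = ren_c f g (dag_c c)).
Proof.
  apply lm_ind; simpl; intros; f_equal; auto.
  rewrite H, H0, ren_shift_mu, ren_shift_lam_mu; reflexivity.
Qed.

Definition dag_ren := proj1 dag_ren_all.

(** Contexts [b(t)], which have no image among the stacks, are left out. *)
Inductive dag_stack : LM.context -> stack -> Prop :=
| dag_stack_var a : dag_stack (LM.KVar a) (SVar a)
| dag_stack_push t e s :
    dag_stack e s -> dag_stack (LM.KPush t e) (SPush (dag t) s).

Lemma dag_stack_ren f g e s :
  dag_stack e s -> dag_stack (LM.ren_k f g e) (ren_s f g s).
Proof.
  induction 1; simpl; rewrite <- ?dag_ren; constructor; assumption.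
Qed.

(** Each push of [e] creates an application, undone by [cut_app] against the part
    of the stack that lies below. *)
Lemma dag_fill e s :
  dag_stack e s ->
  forall t, linear_reduces_c (dag_c (LM.fill e t)) (Cut (dag t) (Stk s)).
Proof.
  induction 1; intros u; simpl.
  - apply rt_refl.
  - eapply rt_trans; [apply IHdag_stack | apply cut_app].
Qed.

(** The two sides differ only at the commands [[a]t] where a context is plugged
    in, and there [dag_fill] relates them. *)
Lemma dag_subst_all :
  (forall t s k r k',
     (forall n, dag (s n) = r n) -> (forall n, dag_stack (k n) (k' n)) ->
     linear_reduces (dag (LM.subst s k t)) (subst r k' (dag t))) /\
  (forall c s k r k',
     (forall n, dag (s n) = r n) -> (forall n, dag_stack (k n) (k' n)) ->
     linear_reduces_c (dag_c (LM.subst_c s k c)) (subst_c r k' (dag_c c))).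
Proof.
  apply lm_ind.
  - simpl; intros x s k r k' Hs _; rewrite Hs; apply rt_refl.
  - simpl; intros t IH s k r k' Hs Hk; apply red_lam, IH.
    + intros [|n]; simpl; [reflexivity|].
      unfold up_lam_t; simpl; rewrite dag_ren, Hs; reflexivity.
    + intros n; apply dag_stack_ren, Hk.
  - intros t IHt u IHu s k r k' Hs Hk.
    change (linear_reduces (app (dag (LM.subst s k t)) (dag (LM.subst s k u)))
              (subst r k' (app (dag t) (dag u)))).
    rewrite subst_app; apply red_app; auto using linear_step_ren.
    + apply linear_step_ren.
    + apply IHt; assumption.
    + apply IHu; assumption.
  - simpl; intros c IH s k r k' Hs Hk; apply red_mu_cong, IH.
    + intros n; rewrite dag_ren, Hs; reflexivity.
    + intros [|n]; simpl; [constructor | apply dag_stack_ren, Hk].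
  - simpl; intros a t IH s k r k' Hs Hk; eapply rt_trans.
    + apply dag_fill, Hk.
    + apply red_cut_l, IH; assumption.
Qed.

Definition dag_subst := proj1 dag_subst_all.
Definition dag_subst_c := proj2 dag_subst_all.

(** * Simulation of one step *)

(** After [app_push], the beta-step names the argument again and the
    mu-tilde-step substitutes it; the remaining command is against the
    mu-variable of the translated application, and theta removes both. *)
Lemma dag_beta u t :
  reduces (dag (LM.App (LM.Lam u) t)) (subst (scons (dag t) Var) SVar (dag u)).
Proof.
  eapply rt_trans; [apply rt_step, linear_step_step, app_push|].
  eapply rt_trans; [apply rt_step, compat_mu, compat_c_root, red_beta|].
  eapply rt_trans; [apply rt_step, compat_mu, compat_c_root, red_mut|].
  apply rt_step, compat_root; simpl.
  replace (subst _ _ _) with (ren idr S (subst (scons (dag t) Var) SVar (dag u)))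
    by exact (ren_subst_lam idr S (dag t) (dag u)).
  constructor.
Qed.

(** The mu-step need not be linear.  The outer [Mu] that survives is the binder
    of the translated application. *)
Lemma dag_mu c t :
  reduces (dag (LM.App (LM.Mu c) t))
    (Mu (subst_c Var
           (scons (SPush (ren idr S (dag t)) (SVar 0)) (fun n => SVar (S n)))
           (dag_c c))).
Proof.
  eapply rt_trans; [apply rt_step, linear_step_step, app_push|].
  rewrite <- (subst_ren_c (dag_c c) idr (upr S) Var
    (scons (SPush (ren idr S (dag t)) (SVar 0)) SVar)).
  - apply rt_step, compat_mu, compat_c_root, red_mu.
  - reflexivity.
  - intros [|n]; reflexivity.
Qed.

Lemma root_term_join t v :
  LM.root_term t v ->
  exists u, reduces (dag t) u /\ linear_reduces (dag v) u.
Proof.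
  intros [u w|c w|w].
  - eexists; split; [apply dag_beta|].
    apply dag_subst; [intros [|n]; reflexivity | constructor].
  - eexists; split; [apply dag_mu|].
    apply red_mu_cong, dag_subst_c; [reflexivity|].
    intros [|n]; simpl; rewrite <- ?dag_ren; repeat constructor.
  - exists (dag w); split; [|apply rt_refl].
    apply rt_step, compat_root; simpl; rewrite dag_ren; constructor.
Qed.

Lemma root_command_join c c' :
  LM.root_command c c' ->
  exists d, reduces_c (dag_c c) d /\ linear_reduces_c (dag_c c') d.
Proof.
  intros [b d]; eexists; split.
  - apply rt_step, compat_c_root, red_mu.
  - apply dag_subst_c; [reflexivity | intros [|n]; constructor].
Qed.

Theorem corollary1 :
  (forall t v : LM.term,
     LM.step t v ->
     exists u : LMT.term,
       LMT.reduces (dag t) u /\ LMT.linear_reduces (dag v) u)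
  /\
  (forall t v : LM.command,
     LM.step_c t v ->
     exists u : LMT.command,
       LMT.reduces_c (dag_c t) u /\ LMT.linear_reduces_c (dag_c v) u).
Proof.
  apply lm_step_ind.
  - exact root_term_join.
  - intros t t' _ [u [H1 H2]]; exists (Lam u); split; apply red_lam; assumption.
  - intros t t' w _ [u [H1 H2]]; exists (app u (dag w)); split;
      apply red_app; try assumption; try apply rt_refl;
      [apply step_ren | apply linear_step_ren].
  - intros w t t' _ [u [H1 H2]]; exists (app (dag w) u); split;
      apply red_app; try assumption; try apply rt_refl;
      [apply step_ren | apply linear_step_ren].
  - intros c c' _ [u [H1 H2]]; exists (Mu u); split;
      apply red_mu_cong; assumption.
  - exact root_command_join.
  - intros a t t' _ [u [H1 H2]]; exists (Cut u (Stk (SVar a))); split;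
      apply red_cut_l; assumption.
Qed.
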